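(* Let $d\ge 1$, $D>0$, $\sigma\ge 0$, $\alpha\in[0,1)$, and let $T$ be a positive integer. Let $w^*\in\mathbb{R}^d$ with $\|w^*\|\le D$, and let $(x,\epsilon,b)$ be mutually independent random variables with $x\in\mathbb{R}^d$, $\|x\|\le 1$ a.s., $\mathbb{E}[x]=0$, $\epsilon\in\mathbb{R}$, $|\epsilon|\le\sigma$ a.s., $\mathbb{E}[\epsilon]=0$, $b\in\mathbb{R}$, $\mathbb{P}(b\neq 0)=\alpha$, and set $y=\langle w^*,x\rangle+\epsilon+b$. Let $R=6D+\sigma$ and let $\bar w$ be the output of the following algorithm: set $w_1=0$ and $\eta=\frac{D}{R\sqrt T}$; for $t=1,\dots,T$, draw a fresh independent sample $(x_t,y_t)$ distributed as $(x,y)$, set $g_t=\phi_R(\langle w_t,x_t\rangle-y_t)\,x_t$ and $w_{t+1}=\Pi_{\mathcal W}(w_t-\eta g_t)$; output $\bar w=\frac1T\sum_{t=1}^T w_t$. Then $$\mathbb{E}[F(\bar w)]-F(w^* )\le \frac{RD}{(1-\alpha)\sqrt T}.$$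
   Context: $\mathcal W=\{w\in\mathbb{R}^d:\|w\|\le D\}$ and $\Pi_{\mathcal W}(u)=\arg\min_{w\in\mathcal W}\|w-u\|$ is the Euclidean projection. $\phi_R(s)=\min\{R,\max\{s,-R\}\}$ (the derivative of the Huber loss $h_R(s)=\frac12 s^2$ if $|s|\le R$, $h_R(s)=R(|s|-\frac12R)$ otherwise). $F(w)=\mathbb{E}_{x,\epsilon}\big[\tfrac12(\langle w,x\rangle-\langle w^*,x\rangle-\epsilon)^2\big]$ is the expected squared loss on uncorrupted data (i.e. with $b=0$). The expectation $\mathbb{E}[F(\bar w)]$ is over the samples drawn by the algorithm. *)

(* Defs.v *)
From HB Require Import structures.
From mathcomp Require Import all_boot all_order all_algebra.
From mathcomp Require Import all_classical all_reals all_analysis.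
Set Implicit Arguments. Unset Strict Implicit. Unset Printing Implicit Defensive.
Import Order.TTheory GRing.Theory Num.Theory.
Local Open Scope classical_set_scope.
Local Open Scope ring_scope.

Section Defs.
Variable R : realType.

Definition dotv (n : nat) (u v : 'rV[R]_n) : R := \sum_(i < n) u ord0 i * v ord0 i.
Definition enorm (n : nat) (v : 'rV[R]_n) : R := Num.sqrt (dotv v v).

Definition projW (n : nat) (D : R) (u : 'rV[R]_n) : 'rV[R]_n :=
  xget 0 [set w | enorm w <= D /\
                  forall w', enorm w' <= D -> enorm (w - u) <= enorm (w' - u)].

Definition phiR (Rr s : R) : R := Num.min Rr (Num.max s (- Rr)).

(* Iterates of projected SGD on the Huber loss (0-indexed: w 0 = w_1 = 0,
   sample t is used to go from w t to w t.+1). *)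
Fixpoint sgd_w (n : nat) (D Rr eta : R) (xs : nat -> 'rV[R]_n) (ys : nat -> R)
  (t : nat) : 'rV[R]_n :=
  match t with
  | 0 => 0
  | t'.+1 => let w := sgd_w D Rr eta xs ys t' in
             projW D (w - eta *: (phiR Rr (dotv w (xs t') - ys t') *: xs t'))
  end.

Definition sgd_out (n : nat) (T : nat) (D Rr : R) (xs : nat -> 'rV[R]_n)
  (ys : nat -> R) : 'rV[R]_n :=
  let eta := D / (Rr * Num.sqrt T%:R) in
  (T%:R)^-1 *: \sum_(t < T) sgd_w D Rr eta xs ys t.

(* Borel sigma-algebra on R^n: generated by the coordinate maps. *)
Definition mxsig (n : nat) : set (set 'rV[R]_n) :=
  <<s [set B | exists (i : 'I_n) (A : set R),
                 measurable A /\ B = (fun v : 'rV[R]_n => v ord0 i) @^-1` A] >>.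

Definition joint (Om : Type) (n : nat) (x : Om -> 'rV[R]_n) (y : Om -> R)
  : Om -> 'rV[R]_(n + 1) := fun w => row_mx (x w) (\row_(j < 1) y w).

End Defs.

Section Prob.
Context {dO : measure_display} {Om : measurableType dO} {R : realType}.
Variable P : probability Om R.

Definition sigma_vec (n : nat) (X : Om -> 'rV[R]_n) : set (set Om) :=
  [set X @^-1` A | A in @mxsig R n].
Definition sigma_real (X : Om -> R) : set (set Om) :=
  [set X @^-1` A | A in (measurable : set (set R))].

Definition mutually_indep (I : finType) (G : I -> set (set Om)) : Prop :=
  forall (J : {set I}) (A : I -> set Om), (forall i, i \in J -> G i (A i)) ->
    P (\big[setI/setT]_(i in J) A i) = \big[*%E/1%E]_(i in J) P (A i).

Definition same_law (n : nat) (X Y : Om -> 'rV[R]_n) : Prop :=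
  forall A, @mxsig R n A -> P (X @^-1` A) = P (Y @^-1` A).

Definition Frisk (n : nat) (x : Om -> 'rV[R]_n) (eps : Om -> R)
  (wstar w : 'rV[R]_n) : R :=
  fine ('E_P[fun o => 2^-1 * (dotv w (x o) - dotv wstar (x o) - eps o) ^+ 2]).

End Prob.

(* Main.v *)
Require Import Defs.
From HB Require Import structures.
From mathcomp Require Import all_boot all_order all_algebra.
From mathcomp Require Import all_classical all_reals all_analysis.
From mathcomp Require Import measurable_realfun ring lra.
Import Order.TTheory GRing.Theory Num.Theory.
Import numFieldNormedType.Exports.
Local Open Scope classical_set_scope.
Local Open Scope ring_scope.

(** Write [s] for [<w - w*, x>] and [phi] for [phiR Rr]. Since [x] is centred and
    independent of [eps],
    [F w - F w* = E[s^2] / 2]. For [|w| <= D] the population gradient satisfies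
    [E[phi(s - eps - b) s] >= (1 - alpha) E[s^2]]: by monotonicity of [phi]
    the difference [(phi(s - eps - b) - phi(- eps - b)) s] is nonnegative, it
    equals [s^2] when [b = 0], and [E[phi(- eps - b) s] = 0] because [x] is
    centred and independent of [(eps, b)]. The deterministic regret bound of
    projected gradient descent bounds the sum of [phi(<w_t, x_t> - y_t) s_t] by
    [Rr D sqrt T]; independence of [w_t] from the sample [t] and convexity of
    [u |-> E[<u, x>^2]] turn it into a bound at the averaged iterate. *)


(** * Projected gradient descent on the Huber loss *)

Section Euclidean.
Context {R : realType} {n : nat}.
Implicit Types (u v w : 'rV[R]_n) (a D : R).

Lemma dotvC u v : dotv u v = dotv v u.
Proof. by apply: eq_bigr => i _; rewrite mulrC. Qed.

Lemma dotvDl u v w : dotv (u + v) w = dotv u w + dotv v w.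
Proof. by rewrite -big_split; apply: eq_bigr => i _; rewrite !mxE mulrDl. Qed.

Lemma dotvZl a u v : dotv (a *: u) v = a * dotv u v.
Proof. by rewrite /dotv mulr_sumr; apply: eq_bigr => i _; rewrite !mxE mulrA. Qed.

Lemma dotvBl u v w : dotv (u - v) w = dotv u w - dotv v w.
Proof. by rewrite dotvDl -scaleN1r dotvZl mulN1r. Qed.

Lemma dotv0l u : dotv 0 u = 0.
Proof. by rewrite -(scale0r 0) dotvZl mul0r. Qed.

Lemma dotvBr u v w : dotv u (v - w) = dotv u v - dotv u w.
Proof. by rewrite dotvC dotvBl !(dotvC u). Qed.

Lemma dotvZr a u v : dotv u (a *: v) = a * dotv u v.
Proof. by rewrite dotvC dotvZl dotvC. Qed.

Lemma dotv_suml (T : nat) (u : nat -> 'rV[R]_n) v :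
  dotv (\sum_(t < T) u t) v = \sum_(t < T) dotv (u t) v.
Proof.
elim: T => [|T IH]; first by rewrite !big_ord0 dotv0l.
by rewrite !big_ord_recr/= dotvDl IH.
Qed.

Lemma dotv_ge0 u : 0 <= dotv u u.
Proof. by apply: sumr_ge0 => i _; rewrite -expr2 sqr_ge0. Qed.

Lemma dotv_eq0 u : dotv u u = 0 -> u = 0.
Proof.
move=> /eqP; rewrite psumr_eq0; last by move=> i _; rewrite -expr2 sqr_ge0.
move=> /allP u0; apply/rowP => i; rewrite mxE.
by have := u0 i (mem_index_enum i); rewrite mulf_eq0 orbb => /eqP.
Qed.

Lemma enorm_ge0 u : 0 <= enorm u.
Proof. exact: sqrtr_ge0. Qed.

Lemma enorm_sqr u : enorm u ^+ 2 = dotv u u.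
Proof. by rewrite sqr_sqrtr// dotv_ge0. Qed.

Lemma enorm_leP u a : 0 <= a -> (enorm u <= a) = (dotv u u <= a ^+ 2).
Proof. by move=> a0; rewrite -enorm_sqr ler_sqr// nnegrE enorm_ge0. Qed.

Lemma enorm_le u v : (enorm u <= enorm v) = (dotv u u <= dotv v v).
Proof. by rewrite enorm_leP ?enorm_ge0// enorm_sqr. Qed.

(** Cauchy-Schwarz: with [b = <v,v>] and [c = <u,v>], the squared norm of [b u - c v] equals
    [b (<u,u> b - c^2)], and [b] divides out unless [v = 0]. *)
Lemma dotv_sqr_le u v : dotv u v ^+ 2 <= dotv u u * dotv v v.
Proof.
have := dotv_ge0 (dotv v v *: u - dotv u v *: v).
rewrite !(dotvBl, dotvBr, dotvZl, dotvZr) (dotvC v u).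
have [v0 _|] := eqVneq (dotv v v) 0.
  by rewrite (dotv_eq0 _ v0) dotvC !dotv0l expr0n mulr0.
move=> vn0; have v0 : 0 < dotv v v by rewrite lt0r vn0 dotv_ge0.
move: (dotv u v) (dotv u u) (dotv v v) v0 => c a b b0 h.
by rewrite -(ler_pM2l b0); lra.
Qed.

Lemma normr_dotv_le u v : `|dotv u v| <= enorm u * enorm v.
Proof.
rewrite -ler_sqr ?nnegrE ?mulr_ge0 ?enorm_ge0//.
by rewrite real_normK ?num_real// exprMn !enorm_sqr dotv_sqr_le.
Qed.

Lemma enorm0 : enorm (0 : 'rV[R]_n) = 0.
Proof. by rewrite /enorm dotv0l sqrtr0. Qed.

Lemma enormB_le u v : enorm (u - v) <= enorm u + enorm v.
Proof.
rewrite enorm_leP ?addr_ge0 ?enorm_ge0// sqrrD !enorm_sqr.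
rewrite !(dotvBl, dotvBr) (dotvC v u).
have := normr_dotv_le u v; rewrite ler_norml => /andP[h _].
by lra.
Qed.

(** Candidate for the projection onto the ball of radius [D]: the maximum makes the factor 1 inside
    the ball and [D / |u|] outside. *)
Let clip D u := (D / Num.max D (enorm u)) *: u.

Lemma enorm_clip D u : 0 < D -> enorm (clip D u) <= D.
Proof.
move=> D0; have m0 : 0 < Num.max D (enorm u) by rewrite lt_max D0.
have D0' := ltW D0; have m0' := ltW m0.
rewrite enorm_leP// dotvZl dotvZr mulrA -expr2 -enorm_sqr -exprMn.
rewrite ler_sqr ?nnegrE ?mulr_ge0 ?enorm_ge0 ?invr_ge0//.
by rewrite -mulrA ler_piMr// mulrC ler_pdivrMr// mul1r le_max lexx orbT.
Qed.

(** Inside the ball [u - clip D u] vanishes. Outside, it is a positive multiple of [u], and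
    Cauchy-Schwarz gives [<u,w> <= D |u| = <u, clip D u>]. *)
Lemma clip_variational D u w : 0 < D -> enorm w <= D ->
  dotv (u - clip D u) (w - clip D u) <= 0.
Proof.
move=> D0 wD; rewrite /clip; have [uD|Du] := leP (enorm u) D.
  by rewrite divff ?gt_eqF// scale1r subrr dotv0l.
set c := D / enorm u; have u0 : 0 < enorm u by exact: lt_trans Du.
have -> : u - c *: u = (1 - c) *: u by rewrite scalerBl scale1r.
have c1 : 0 <= 1 - c by rewrite subr_ge0 ler_pdivrMr// mul1r ltW.
rewrite dotvZl pmulr_rle0 ?dotvBr ?dotvZr ?subr_le0; last first.
  by rewrite lt0r c1 subr_eq0 eq_sym andbT /c lt_eqF// ltr_pdivrMr// mul1r.
rewrite -enorm_sqr /c expr2 mulrA divfK ?gt_eqF//.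
apply: le_trans (ler_norm _) _; apply: le_trans (normr_dotv_le _ _) _.
by rewrite mulrC ler_wpM2r// enorm_ge0.
Qed.

(** Expanding [|w - u|^2] around [clip D u] leaves a cross term whose sign is given by
    [clip_variational]. Minimality and uniqueness of the projection, and its not moving away from
    points of the ball, all follow. *)
Lemma clip_dist D u w : 0 < D -> enorm w <= D ->
  dotv (clip D u - u) (clip D u - u) + dotv (clip D u - w) (clip D u - w)
    <= dotv (w - u) (w - u).
Proof.
move=> D0 wD; have := clip_variational D u w D0 wD.
move: (clip D u) => p; rewrite !(dotvBl, dotvBr) !(dotvC w) !(dotvC p u).
by lra.
Qed.

(** A closed form for the chosen minimizer, from which measurability of the projection can be read
    off. *)
Lemma projWE D u : 0 < D -> projW D u = (D / Num.max D (enorm u)) *: u.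
Proof.
move=> D0; rewrite -/(clip D u) /projW; set S := [set _ | _].
have pD := enorm_clip D u D0.
(* [clip D u] is a minimizer, so [xget] does not fall back on its default 0. *)
have /(xgetI 0)[wD wmin] : S (clip D u).
  split=> // w wD; rewrite enorm_le; have := clip_dist D u w D0 wD.
  by have := dotv_ge0 (clip D u - w); lra.
have := wmin _ pD; rewrite enorm_le => h.
(* Uniqueness: the chosen point is at least as close to [u] as [clip D u], so the squared distance
   between the two in [clip_dist] must be zero. *)
have := clip_dist D u _ D0 wD => h'.
apply/esym/eqP; rewrite -subr_eq0; apply/eqP/dotv_eq0.
by apply/eqP; rewrite eq_le dotv_ge0 andbT; lra.
Qed.

Lemma projW_le D u : 0 < D -> enorm (projW D u) <= D.
Proof. by move=> D0; rewrite projWE// enorm_clip. Qed.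

Lemma projW_dist D u w : 0 < D -> enorm w <= D ->
  dotv (projW D u - w) (projW D u - w) <= dotv (u - w) (u - w).
Proof.
move=> D0 wD; have := clip_dist D u w D0 wD; rewrite projWE// -/(clip D u).
have := dotv_ge0 (clip D u - u).
by rewrite !(dotvBl, dotvBr) (dotvC w u); lra.
Qed.

End Euclidean.

(** * The clipped residual *)

Section Huber.
Context {R : realType}.
Implicit Types (r s e b : R).

Lemma phiR_le r s : 0 <= r -> `|phiR r s| <= r.
Proof.
move=> r0; rewrite /phiR ler_norml ge_min lexx andbT le_min le_max lexx orbT.
by rewrite andbT; lra.
Qed.

Lemma phiR_id r s : `|s| <= r -> phiR r s = s.
Proof.
rewrite ler_norml => /andP[h1 h2].
by rewrite /phiR (max_idPl _)// (min_idPr _).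
Qed.

Lemma phiR_homo r : {homo phiR r : s t / s <= t}.
Proof.
move=> s t st; rewrite /phiR.
by rewrite le_min ge_min lexx/= ge_min ge_max !le_max st lexx !orbT.
Qed.

(* Uncorrupted samples fall in the quadratic part of the Huber loss; on
   corrupted ones only the monotonicity of [phiR r] is available. *)
Lemma phiR_mul_ge r s e b : `|s| + `|e| <= r ->
  s * phiR r (- e - b) + (b == 0)%:R * s ^+ 2 <= s * phiR r (s - e - b).
Proof.
move=> h; have [->|b0] := eqVneq b 0.
  have he : `|- e| <= r by rewrite normrN; apply: le_trans h; rewrite lerDr.
  have hs : `|s - e| <= r by apply: le_trans h; exact: ler_normB.
  by rewrite !subr0 !phiR_id//= mulr1n; lra.
rewrite mul0r addr0; have [s0|s0] := leP 0 s.
  by rewrite ler_wpM2l// phiR_homo//; lra.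
by rewrite ler_nM2l// phiR_homo//; lra.
Qed.

End Huber.

(** * Deterministic regret bound *)

Section Regret.
Context {R : realType} {n : nat}.
Variables (D r eta : R) (xs : nat -> 'rV[R]_n) (ys : nat -> R).
Hypotheses (D0 : 0 < D) (r0 : 0 <= r).
Let w := sgd_w D r eta xs ys.
Let g t := phiR r (dotv (w t) (xs t) - ys t) *: xs t.

Lemma sgd_w_le t : enorm (w t) <= D.
Proof. by case: t => [|t]; [rewrite enorm0 ltW|exact: projW_le]. Qed.

(** Telescoping of [|w t - v|^2]: projecting does not increase the distance to [v], so step [t]
    changes it by at most [- 2 eta <w t - v, g t> + eta^2 |g t|^2]. It starts from [|v|^2 <= D^2]
    because [w 0 = 0]. *)
Lemma sgd_regret (T : nat) (v : 'rV[R]_n) : enorm v <= D ->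
  (forall t, (t < T)%N -> enorm (xs t) <= 1) ->
  2 * eta * \sum_(t < T) dotv (w t - v) (g t) <=
  D ^+ 2 + T%:R * (eta * r) ^+ 2.
Proof.
(* The induction keeps the last squared distance, dropped at the end as nonnegative; the bound on
   the samples is restated so that its range shrinks with [T]. *)
move=> vD; suff H : (forall t, (t < T)%N -> enorm (xs t) <= 1) ->
    dotv (w T - v) (w T - v) + 2 * eta * \sum_(t < T) dotv (w t - v) (g t) <=
    D ^+ 2 + T%:R * (eta * r) ^+ 2.
  by move=> /H; have := dotv_ge0 (w T - v); lra.
elim: T => [_|T IH xs1].
  rewrite big_ord0 mulr0 mul0r !addr0 /= sub0r -scaleN1r dotvZl dotvZr.
  by rewrite !mulN1r opprK -enorm_leP//; exact: ltW.
have {IH} := IH (fun t tT => xs1 t (ltn_trans tT (ltnSn T))).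
have : dotv (w T.+1 - v) (w T.+1 - v) <=
    dotv (w T - eta *: g T - v) (w T - eta *: g T - v).
  exact: projW_dist.
have -> : w T - eta *: g T - v = (w T - v) - eta *: g T.
  by rewrite -!addrA [- _ - _]addrC.
(* [|g T| <= r], since [phiR r] is bounded by [r] and the sample has norm at most 1. *)
have : eta ^+ 2 * dotv (g T) (g T) <= (eta * r) ^+ 2.
  rewrite exprMn ler_wpM2l ?sqr_ge0// dotvZl dotvZr mulrA -expr2.
  rewrite -[r ^+ 2]mulr1 ler_pM ?sqr_ge0 ?dotv_ge0//.
    by rewrite -real_normK ?num_real// ler_sqr ?nnegrE// phiR_le.
  by have := xs1 T (ltnSn T); rewrite enorm_leP// expr1n.
rewrite big_ord_recr/= -/(g T); move: (g T) => h.
rewrite (dotvBl (w T - v)) !(dotvBr _ (w T - v)) !dotvZl !dotvZr (dotvC h).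
rewrite -(addn1 T) natrD.
by lra.
Qed.

End Regret.

(** * Measurability of vectors and iterates *)

Section VectorMeasurability.
Context {R : realType}.

Definition mxgen (n : nat) : set (set 'rV[R]_n) :=
  [set B | exists (i : 'I_n) (A : set R),
     measurable A /\ B = (fun v : 'rV[R]_n => v ord0 i) @^-1` A].

(* The measurable sets of [mxT n] are, by conversion, those of [mxsig n]. *)
Definition mxT (n : nat) := g_sigma_algebraType (mxgen n).

(** The coordinatewise form matches the hypotheses of the theorem and is stable under vector
    operations; [measurable_coordsP] turns it into measurability into [mxT n]. *)
Definition measurable_coords {d} {T : measurableType d} {n : nat}
    (f : T -> 'rV[R]_n) :=
  forall i : 'I_n, measurable_fun setT (fun o => f o ord0 i).

Lemma measurable_coords_id n : measurable_coords (id : mxT n -> 'rV[R]_n).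
Proof.
move=> i _ A mA; rewrite setTI; apply: sub_sigma_algebra.
by exists i, A.
Qed.

Context {d} {T : measurableType d}.

Lemma measurable_coordsP n (f : T -> 'rV[R]_n) :
  measurable_coords f -> measurable_fun setT (f : T -> mxT n).
Proof.
move=> mf; apply: (@measurability _ _ T (mxT n) setT f (mxgen n)) => //.
move=> _ [_ [i [A [mA ->]]] <-]; rewrite setTI.
by have := mf i measurableT _ mA; rewrite setTI.
Qed.

Lemma measurable_fun_dotv n (f g : T -> 'rV[R]_n) :
  measurable_coords f -> measurable_coords g ->
  measurable_fun setT (fun o => dotv (f o) (g o)).
Proof.
by move=> mf mg; apply: measurable_sum => i; apply: measurable_funM.
Qed.

Lemma measurable_coordsZ n (a : T -> R) (f : T -> 'rV[R]_n) :
  measurable_fun setT a -> measurable_coords f ->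
  measurable_coords (fun o => a o *: f o).
Proof.
move=> ma mf i; under eq_fun do rewrite mxE.
exact: measurable_funM.
Qed.

Lemma measurable_coordsB n (f g : T -> 'rV[R]_n) :
  measurable_coords f -> measurable_coords g ->
  measurable_coords (fun o => f o - g o).
Proof.
move=> mf mg i; under eq_fun do rewrite !mxE.
exact: measurable_funB.
Qed.

Lemma measurable_coords_sum n (N : nat) (f : nat -> T -> 'rV[R]_n) :
  (forall t, (t < N)%N -> measurable_coords (f t)) ->
  measurable_coords (fun o => \sum_(t < N) f t o).
Proof.
move=> mf i; under eq_fun do rewrite summxE.
by apply: measurable_sum => t; exact: mf.
Qed.

Lemma measurable_coords_cst n (v : 'rV[R]_n) :
  measurable_coords (fun _ : T => v).
Proof. by move=> i; exact: measurable_cst. Qed.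

Lemma measurable_fun_enorm n (f : T -> 'rV[R]_n) :
  measurable_coords f -> measurable_fun setT (fun o => enorm (f o)).
Proof.
move=> mf; apply: (measurableT_comp (f := @Num.sqrt R)).
  by apply: continuous_measurable_fun; exact: sqrt_continuous.
exact: measurable_fun_dotv.
Qed.

Lemma measurable_coords_projW n (D : R) (f : T -> 'rV[R]_n) : 0 < D ->
  measurable_coords f -> measurable_coords (fun o => projW D (f o)).
Proof.
move=> D0 mf; under eq_fun do rewrite projWE//.
apply: measurable_coordsZ => //; apply: measurable_funM => //.
(* The maximum is positive, so its inverse is the real power of exponent -1, a measurable
   function. *)
have -> : (fun o => (Num.max D (enorm (f o)))^-1) =
    (fun o => Num.max D (enorm (f o)) `^ (-1)).
  by apply/funext => o; rewrite powR_inv1// le_max (ltW D0).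
apply: (measurableT_comp (f := @powR R ^~ (-1))); first exact: measurable_powR.
by apply: measurable_maxr => //; exact: measurable_fun_enorm.
Qed.

Lemma measurable_phiR (r : R) (f : T -> R) :
  measurable_fun setT f -> measurable_fun setT (fun o => phiR r (f o)).
Proof.
by move=> mf; apply: measurable_minr => //; exact: measurable_maxr.
Qed.

(** Only the samples before [k] enter. The domain is arbitrary, so that the lemma serves both for
    [Om] and for the sigma-algebra of the past samples. *)
Lemma measurable_sgd_w n (D r eta : R) (xs : nat -> T -> 'rV[R]_n)
    (ys : nat -> T -> R) (k : nat) : 0 < D ->
  (forall t, (t < k)%N ->
     measurable_coords (xs t) /\ measurable_fun setT (ys t)) ->
  measurable_coords (fun o => sgd_w D r eta (xs^~ o) (ys^~ o) k).
Proof.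
move=> D0; elim: k => [_|k IH mxy]; first exact: measurable_coords_cst.
have {}IH := IH (fun t tk => mxy t (ltn_trans tk (ltnSn k))).
have [mx my] := mxy k (ltnSn k).
apply: measurable_coords_projW => //; apply: measurable_coordsB => //.
apply: measurable_coordsZ => //; apply: measurable_coordsZ => //.
apply: measurable_phiR; apply: measurable_funB => //.
exact: measurable_fun_dotv.
Qed.

End VectorMeasurability.
Arguments mxT R n : clear implicits.

(** * Independence and Fubini *)

Section IndependentClasses.
Context {dO : measure_display} {Om : measurableType dO} {R : realType}.
Context {I : finType}.
Variables (P : probability Om R) (G : I -> set (set Om)).
Hypotheses (GI : forall i, setI_closed (G i)) (GT : forall i, G i setT)
  (Gm : forall i, G i `<=` measurable) (indG : mutually_indep P G).

(** For classes closed under intersection and containing [setT], a pi-system generating the join of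
    the sigma-algebras of the [G i], [i] in [J]. *)
Definition meet_system (J : {set I}) : set (set Om) :=
  [set B | exists A : I -> set Om, (forall i, i \in J -> G i (A i)) /\
     B = \big[setI/setT]_(i in J) A i].

Lemma meet_system_sub (J : {set I}) i : i \in J -> G i `<=` meet_system J.
Proof.
move=> iJ A GA; exists (fun j => if j == i then A else setT); split.
  by move=> j _; case: eqP => [->|].
rewrite (bigD1 i)//= eqxx big1 ?setIT// => j /andP[_ /negbTE ->//].
Qed.

Lemma meet_system_measurable (J : {set I}) : meet_system J `<=` measurable.
Proof.
move=> _ [A [GA ->]]; elim/big_rec: _ => // i B iJ mB.
by apply: measurableI => //; exact/Gm/GA.
Qed.

Lemma meet_systemI (J : {set I}) : setI_closed (meet_system J).
Proof.
move=> _ _ [A [GA ->]] [B [GB ->]]; exists (fun i => A i `&` B i).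
by split=> [i iJ|]; [apply: GI; [exact: GA|exact: GB]|rewrite big_split].
Qed.

(* [meet_system J] is a pi-system, so it suffices to compare the measures
   [A |-> P (A `&` B)] and [A |-> P A * P B] on it. *)
Lemma indep_sigma_meet_system (J : {set I}) k A B : k \notin J ->
  <<s meet_system J >> A -> G k B -> P (A `&` B) = (P A * P B)%E.
Proof.
move=> kJ sA GB; have mB := Gm _ _ GB.
have PB0 : 0 <= fine (P B) by exact: fine_ge0.
have PBE : P B = (NngNum PB0)%:num%:E by rewrite /= fineK// fin_num_measure.
rewrite muleC PBE -[LHS]/(mrestr P mB A) -[RHS]/(mscale (NngNum PB0) P A).
apply: (g_sigma_algebra_measure_unique (meet_system J)
  (meet_system_measurable J) (fun=> setT)) => //.
- by move=> _; exists (fun=> setT); rewrite big1.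
- by apply/seteqP; split=> // o _; exists 0%N.
- exact: meet_systemI.
- move=> _ [C [GC ->]]; set D := (X in _ X = _).
  rewrite -[LHS]/(P (D `&` B)) -[RHS]/((NngNum PB0)%:num%:E * P D)%E -PBE.
  rewrite muleC {}/D.
  rewrite (indG J)//.
  (* Independence is applied to [k |: J], with the family [C] extended by [B] at [k]; the extension
     is consistent because [k] is outside [J]. *)
  pose C' i := if i == k then B else C i.
  have C'k : C' k = B by rewrite /C' eqxx.
  have C'C i : i \in J -> C' i = C i.
    by rewrite /C'; case: eqP => // ->; rewrite (negbTE kJ).
  have := indG (k |: J) C'; rewrite !big_setU1//= C'k (eq_bigr _ C'C).
  rewrite (eq_bigr (fun i => P (C i))); last by move=> i /C'C ->.
  rewrite setIC muleC => -> // i; rewrite in_setU1 /C'.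
  by case: eqP => [->//|_ /= /GC].
- move=> _; rewrite -[ltLHS]/(P (setT `&` B)) setTI; apply: le_lt_trans (ltry 1%R).
  exact: probability_le1.
Qed.

End IndependentClasses.

(** * Integrals of functions of two independent maps *)

Section Expectations.
Context {dO : measure_display} {Om : measurableType dO} {R : realType}.
Variable P : probability Om R.

Lemma ae_bounded_integrable (f : Om -> R) (M : R) : measurable_fun setT f ->
  {ae P, forall o, `|f o| <= M} -> P.-integrable setT (EFin \o f).
Proof.
move=> mf fM; apply/integrableP; split; first exact/measurable_EFinP.
apply: (@le_lt_trans _ _ `|M|%:E); last exact: ltry.
apply: (@le_trans _ _ (\int[P]_o (cst `|M|%:E o))%E); last first.
  by rewrite integral_cst//= probability_setT mule1.
apply: ae_ge0_le_integral => //.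
- by apply: measurableT_comp => //; exact/measurable_EFinP.
- by move=> o _; rewrite lee_fin.
- move: fM; apply: filterS => o h _.
  by rewrite lee_fin (le_trans h)// ler_norm.
Qed.

Definition indep_maps {d1 d2} {T1 : measurableType d1} {T2 : measurableType d2}
    (X1 : Om -> T1) (X2 : Om -> T2) :=
  forall A B, measurable A -> measurable B ->
    P (X1 @^-1` A `&` X2 @^-1` B) = (P (X1 @^-1` A) * P (X2 @^-1` B))%E.

Context {d1 d2} {T1 : measurableType d1} {T2 : measurableType d2}.
Variables (X1 : Om -> T1) (X2 : Om -> T2).
Hypotheses (mX1 : measurable_fun setT X1) (mX2 : measurable_fun setT X2)
  (indX : indep_maps X1 X2).

(* Under independence the law of [(X1, X2)] is the product of the laws. *)
Lemma indep_fubini (h : T1 * T2 -> R) : measurable_fun setT h ->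
  P.-integrable setT (fun o => (h (X1 o, X2 o))%:E) ->
  (forall a, P.-integrable setT (fun o => (h (a, X2 o))%:E)) ->
  P.-integrable setT (fun o => \int[P]_o' (h (X1 o, X2 o'))%:E)%E /\
  (\int[P]_o (h (X1 o, X2 o))%:E = \int[P]_o \int[P]_o' (h (X1 o, X2 o'))%:E)%E.
Proof.
move=> mh ih iha.
pose Y1 : {RV P >-> T1} := mfun_Sub (mem_set mX1).
pose Y2 : {RV P >-> T2} := mfun_Sub (mem_set mX2).
have mX : measurable_fun setT (fun o => (X1 o, X2 o)).
  exact: measurable_fun_pair.
pose Y : {RV P >-> (T1 * T2)%type} := mfun_Sub (mem_set mX).
(* Independence is the product formula on rectangles, which determines the product measure. *)
have prodE (A : set (T1 * T2)) : measurable A ->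
    (distribution P Y1 \x distribution P Y2)%E A = distribution P Y A.
  by apply: product_measure_unique => B C mB mC; exact: indX.
have mh' : measurable_fun setT (EFin \o h) by exact/measurable_EFinP.
have iY : (distribution P Y).-integrable setT (EFin \o h).
  exact: integrable_pushforward.
have iprod : (distribution P Y1 \x distribution P Y2)%E.-integrable setT
    (EFin \o h).
  apply/integrableP; split=> //.
  rewrite (eq_measure_integral (distribution P Y)); last first.
    by move=> A mA _; exact: prodE.
  by case/integrableP: iY.
pose F := fubini_F (distribution P Y2) (EFin \o h).
have FE a : F a = (\int[P]_o (h (a, X2 o))%:E)%E.
  rewrite /F /fubini_F integral_distribution//.
    by apply: (measurableT_comp mh'); exact: pair1_measurable.
  exact: iha.
have iF := integrable_fubini_F iprod.
have mF : measurable_fun setT F by exact: measurable_int iF.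
have iFX : P.-integrable setT (F \o X1).
  apply/integrableP; split; first exact: measurableT_comp.
  have /integrableP[_] := iF; rewrite ge0_integral_distribution//.
  exact: measurableT_comp.
split.
  by apply: eq_integrable iFX => // o _; rewrite /= FE.
transitivity (\int[distribution P Y]_z (EFin \o h) z)%E.
  by rewrite integral_distribution.
rewrite (eq_measure_integral (distribution P Y1 \x distribution P Y2)%E).
  2: by move=> A mA _; exact/esym/prodE.
rewrite -integral12_prod_meas1// integral_distribution//.
by apply: eq_integral => o _; rewrite /= -FE.
Qed.

(** Integrability for every frozen [a] makes each inner integral finite, so [indep_fubini] passes to
    real-valued integrals. *)
Lemma indep_Rintegral (h : T1 * T2 -> R) : measurable_fun setT h ->
  P.-integrable setT (EFin \o (fun o => h (X1 o, X2 o))) ->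
  (forall a, P.-integrable setT (EFin \o (fun o => h (a, X2 o)))) ->
  P.-integrable setT (EFin \o (fun o => \int[P]_o' h (X1 o, X2 o'))) /\
  \int[P]_o h (X1 o, X2 o) = \int[P]_o \int[P]_o' h (X1 o, X2 o').
Proof.
move=> mh ih iha; have [iF FE] := indep_fubini h mh ih iha.
have E o : (\int[P]_o' (h (X1 o, X2 o'))%:E)%E =
    (\int[P]_o' h (X1 o, X2 o'))%:E.
  by rewrite fineK// integrable_fin_num//; exact: iha.
split; first by apply: eq_integrable iF => // o _; rewrite E.
by rewrite /Rintegral FE; congr fine; apply: eq_integral => o _; rewrite E.
Qed.

End Expectations.

(** * Independence of a joint sigma-algebra from a single variable *)

Section IndependentClassMaps.
Context {dO : measure_display} {Om : measurableType dO} {R : realType}.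
Context {I : finType}.
Variables (P : probability Om R) (G : I -> set (set Om)).
Hypotheses (GI : forall i, setI_closed (G i)) (GT : forall i, G i setT)
  (Gm : forall i, G i `<=` measurable) (indG : mutually_indep P G).
Variable J : {set I}.
(** [Om] with the coarser sigma-algebra generated by the classes in [J]. The identity into [S] acts
    as one random variable carrying all their information, to which the two-map Fubini results
    apply. *)
Let S := g_sigma_algebraType (meet_system G J).

Lemma measurable_id_meet_system : measurable_fun setT (id : Om -> S).
Proof.
move=> _ A mA; rewrite setTI; move: A mA; apply: smallest_sub.
  exact: sigma_algebra_measurable.
exact: (meet_system_measurable _ Gm).
Qed.

Lemma indep_maps_meet_system {d2} {T2 : measurableType d2} k (X : Om -> T2) :
  k \notin J -> (forall B, measurable B -> G k (X @^-1` B)) ->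
  indep_maps P (id : Om -> S) X.
Proof.
move=> kJ GX A B mA mB.
exact: (indep_sigma_meet_system P G GI GT Gm indG J k A _ kJ mA (GX _ mB)).
Qed.

Lemma measurable_meet_system {d2} {T2 : measurableType d2} k (X : Om -> T2) :
  k \in J -> (forall B, measurable B -> G k (X @^-1` B)) ->
  measurable_fun setT (X : S -> T2).
Proof.
move=> kJ GX _ B mB; rewrite setTI; apply: sub_sigma_algebra.
exact: (meet_system_sub G GT J k kJ _ (GX _ mB)).
Qed.

End IndependentClassMaps.

Section PreimageClass.
Context {d1 d2} {T1 : measurableType d1} {T2 : measurableType d2}.
Variable X : T1 -> T2.

(** Common form, by conversion, of [sigma_real] and of [sigma_vec] (with target [mxT n]). *)
Definition preimages : set (set T1) :=
  [set X @^-1` A | A in (measurable : set (set T2))].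

Lemma preimages_setI : setI_closed preimages.
Proof.
move=> _ _ [A mA <-] [B mB <-]; exists (A `&` B) => //.
exact: measurableI.
Qed.

Lemma preimagesT : preimages setT.
Proof. by exists setT. Qed.

Lemma preimages_measurable :
  measurable_fun setT X -> preimages `<=` measurable.
Proof. by move=> mX _ [A mA <-]; rewrite -[_ @^-1` _]setTI; exact: mX. Qed.

End PreimageClass.

(** * Almost surely bounded functions *)

Section AeBounded.
Context {dO : measure_display} {Om : measurableType dO} {R : realType}.
Variable P : probability Om R.
Implicit Types (f g : Om -> R).

(** Closed under sums and products and contained in the integrable functions, so that integrability
    conditions reduce to closure properties. *)
Definition ae_bounded f :=
  measurable_fun setT f /\ exists M, {ae P, forall o, `|f o| <= M}.

Lemma ae_bounded_cst (c : R) : ae_bounded (fun=> c).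
Proof. by split=> //; exists `|c|; exact: aeW. Qed.

Lemma ae_boundedD f g :
  ae_bounded f -> ae_bounded g -> ae_bounded (fun o => f o + g o).
Proof.
move=> [mf [M fM]] [mg [N gN]]; split; first exact: measurable_funD.
exists (M + N); move: fM gN; apply: filterS2 => o fM gN.
by rewrite (le_trans (ler_normD _ _))// lerD.
Qed.

Lemma ae_boundedM f g :
  ae_bounded f -> ae_bounded g -> ae_bounded (fun o => f o * g o).
Proof.
move=> [mf [M fM]] [mg [N gN]]; split; first exact: measurable_funM.
exists (M * N); move: fM gN; apply: filterS2 => o fM gN.
by rewrite normrM ler_pM.
Qed.

Lemma ae_bounded_sqr f : ae_bounded f -> ae_bounded (fun o => f o ^+ 2).
Proof. by move=> bf; exact: ae_boundedM. Qed.

Lemma ae_bounded_sum (N : nat) (f : nat -> Om -> R) :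
  (forall t, (t < N)%N -> ae_bounded (f t)) ->
  ae_bounded (fun o => \sum_(t < N) f t o).
Proof.
elim: N => [_|N IH bf].
  by under eq_fun do rewrite big_ord0; exact: ae_bounded_cst.
under eq_fun do rewrite big_ord_recr/=.
apply: ae_boundedD; last exact: bf.
by apply: IH => t tN; apply: bf; exact: ltn_trans (ltnSn N).
Qed.

Lemma ae_boundedP f : ae_bounded f -> P.-integrable setT (EFin \o f).
Proof. by move=> [mf [M]]; exact: ae_bounded_integrable. Qed.

Lemma Rintegral_sum (N : nat) (f : nat -> Om -> R) :
  (forall t, (t < N)%N -> ae_bounded (f t)) ->
  \int[P]_o (\sum_(t < N) f t o) = \sum_(t < N) \int[P]_o f t o.
Proof.
elim: N => [_|N IH bf].
  under eq_Rintegral do rewrite big_ord0.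
  by rewrite big_ord0 Rintegral_cst// mul0r.
under eq_Rintegral do rewrite big_ord_recr/=.
have bf' t : (t < N)%N -> ae_bounded (f t).
  by move=> tN; apply: bf; exact: ltn_trans (ltnSn N).
rewrite RintegralD//; first by rewrite big_ord_recr/= IH.
  by apply: ae_boundedP; exact: ae_bounded_sum.
by apply: ae_boundedP; exact: bf.
Qed.

(* Integrating [min f g], equal to [f] a.e., reduces to a pointwise bound. *)
Lemma ae_le_Rintegral f g : ae_bounded f -> ae_bounded g ->
  {ae P, forall o, f o <= g o} -> \int[P]_o f o <= \int[P]_o g o.
Proof.
move=> bf bg fg.
have mfg : measurable_fun setT (fun o => Num.min (f o) (g o)).
  by apply: measurable_minr; [case: bf|case: bg].
have bfg : ae_bounded (fun o => Num.min (f o) (g o)).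
  split=> //; have [_ [M fM]] := bf; exists M.
  by move: fM fg; apply: filterS2 => o fM /min_idPl ->.
have -> : \int[P]_o f o = \int[P]_o Num.min (f o) (g o).
  congr fine; apply: ae_eq_integral => //.
  - by case: bf => mf _; exact/measurable_EFinP.
  - exact/measurable_EFinP.
  - by move: fg; apply: filterS => o /min_idPl -> _.
apply: le_Rintegral => //; [exact: ae_boundedP|exact: ae_boundedP|].
by move=> o _; rewrite ge_min lexx orbT.
Qed.

Lemma Rintegral_cstT (c : R) : \int[P]_o (fun=> c) o = c.
Proof. by rewrite Rintegral_cst//= probability_setT mulr1. Qed.

End AeBounded.

Lemma indep_RintegralM {dO} {Om : measurableType dO} {R : realType}
    (P : probability Om R) {d1 d2} {T1 : measurableType d1}
    {T2 : measurableType d2} (X1 : Om -> T1) (X2 : Om -> T2)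
    (f : T1 -> R) (g : T2 -> R) :
  measurable_fun setT X1 -> measurable_fun setT X2 -> indep_maps P X1 X2 ->
  measurable_fun setT f -> measurable_fun setT g ->
  ae_bounded P (f \o X1) -> ae_bounded P (g \o X2) ->
  \int[P]_o (f (X1 o) * g (X2 o)) =
  (\int[P]_o f (X1 o)) * (\int[P]_o g (X2 o)).
Proof.
move=> mX1 mX2 ind mf mg bf bg.
have [||a|_ ->] := indep_Rintegral P X1 X2 mX1 mX2 ind (fun z => f z.1 * g z.2).
- by apply: measurable_funM; apply: measurableT_comp.
- by apply: ae_boundedP; exact: (ae_boundedM _ _ _ bf bg).
- by apply: ae_boundedP; exact: (ae_boundedM _ _ _ (ae_bounded_cst _ (f a)) bg).
transitivity (\int[P]_o (f (X1 o) * \int[P]_o' g (X2 o'))).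
  by apply: eq_Rintegral => o _; rewrite /= RintegralZl//; exact: ae_boundedP.
by rewrite RintegralZr//; exact: ae_boundedP.
Qed.

(** Jensen for the square: the empirical variance, a sum of squares [(a t - m) ^+ 2], is
    nonnegative. *)
Lemma sqr_mean_le {R : realType} (N : nat) (a : nat -> R) : (0 < N)%N ->
  (N%:R^-1 * \sum_(t < N) a t) ^+ 2 <= N%:R^-1 * \sum_(t < N) a t ^+ 2.
Proof.
move=> N0; have N0' : 0 < N%:R :> R by rewrite ltr0n.
set m := N%:R^-1 * _; have mE : \sum_(t < N) a t = N%:R * m.
  by rewrite /m mulVKf// gt_eqF.
have : 0 <= \sum_(t < N) (a t - m) ^+ 2.
  by apply: sumr_ge0 => t _; exact: sqr_ge0.
have -> : \sum_(t < N) (a t - m) ^+ 2 =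
    \sum_(t < N) a t ^+ 2 - 2 * m * \sum_(t < N) a t + N%:R * m ^+ 2.
  have -> : N%:R * m ^+ 2 = \sum_(t < N) m ^+ 2.
    by rewrite sumr_const card_ord mulr_natl.
  rewrite mulr_sumr -sumrB -big_split/=.
  by apply: eq_bigr => t _; ring.
rewrite mE ler_pdivlMl// => h; rewrite -subr_ge0.
by apply: le_trans h _; rewrite le_eqVlt; apply/orP; left; apply/eqP; ring.
Qed.

Lemma normr_coord_le {R : realType} {n : nat} (v : 'rV[R]_n) (i : 'I_n) :
  `|v ord0 i| <= enorm v.
Proof.
rewrite -ler_sqr ?nnegrE ?enorm_ge0// real_normK ?num_real// enorm_sqr.
rewrite /dotv (bigD1 i)//= expr2 lerDl sumr_ge0// => j _.
by rewrite -expr2 sqr_ge0.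
Qed.

(** * Random vectors, pairs and equality of laws *)

Section VectorLaws.
Context {dO : measure_display} {Om : measurableType dO} {R : realType}.
Variable P : probability Om R.

Lemma ae_bounded_dotv n (W X : Om -> 'rV[R]_n) (C : R) :
  measurable_coords W -> measurable_coords X ->
  (forall o, enorm (W o) <= C) -> {ae P, forall o, enorm (X o) <= 1} ->
  ae_bounded P (fun o => dotv (W o) (X o)).
Proof.
move=> mW mX WC X1; split; first exact: measurable_fun_dotv.
exists C; move: X1; apply: filterS => o Xo.
rewrite (le_trans (normr_dotv_le _ _))// (le_trans _ (WC o))//.
by rewrite ler_piMr// enorm_ge0.
Qed.

Lemma ae_bounded_phiR (r : R) (f : Om -> R) : 0 <= r ->
  measurable_fun setT f -> ae_bounded P (fun o => phiR r (f o)).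
Proof.
move=> r0 mf; split; first exact: measurable_phiR.
by exists r; apply: aeW => o; exact: phiR_le.
Qed.

Lemma measurable_coords_joint n (X : Om -> 'rV[R]_n) (Y : Om -> R) :
  measurable_coords X -> measurable_fun setT Y -> measurable_coords (joint X Y).
Proof.
move=> mX mY i.
have -> : (fun o => joint X Y o ord0 i) =
    match fintype.split i with inl j => fun o => X o ord0 j | inr _ => Y end.
  by apply/funext => o; rewrite mxE; case: (fintype.split i) => k //; rewrite mxE.
by case: (fintype.split i) => [j|_]; [exact: mX|].
Qed.

Lemma lsubmx_joint n (X : Om -> 'rV[R]_n) (Y : Om -> R) o :
  lsubmx (joint X Y o) = X o.
Proof. exact: row_mxKl. Qed.

Lemma last_joint n (X : Om -> 'rV[R]_n) (Y : Om -> R) o :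
  joint X Y o ord0 (rshift n ord0) = Y o.
Proof. by rewrite row_mxEr mxE. Qed.

Lemma same_law_Rintegral n (X Y : Om -> 'rV[R]_n) (h : mxT R n -> R) :
  measurable_coords X -> measurable_coords Y -> same_law P X Y ->
  measurable_fun setT h -> ae_bounded P (h \o X) -> ae_bounded P (h \o Y) ->
  \int[P]_o h (X o) = \int[P]_o h (Y o).
Proof.
move=> /measurable_coordsP mX /measurable_coordsP mY XY mh bX bY.
pose X' : {RV P >-> mxT R n} := mfun_Sub (mem_set mX).
pose Y' : {RV P >-> mxT R n} := mfun_Sub (mem_set mY).
have mh' : measurable_fun setT (EFin \o h) by exact/measurable_EFinP.
congr fine; transitivity (\int[distribution P X']_z (EFin \o h) z)%E.
  by rewrite integral_distribution//; exact: ae_boundedP.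
rewrite (eq_measure_integral (distribution P Y')).
  by rewrite integral_distribution//; exact: ae_boundedP.
by move=> A mA _; exact: XY.
Qed.

(** Equal laws give the complement of [A] the same probability under both vectors, here zero. *)
Lemma same_law_ae n (X Y : Om -> 'rV[R]_n) (A : set (mxT R n)) :
  measurable_coords X -> measurable_coords Y -> same_law P X Y ->
  measurable A -> {ae P, forall o, A (Y o)} -> {ae P, forall o, A (X o)}.
Proof.
move=> /measurable_coordsP mX /measurable_coordsP mY XY mA.
have mAC := measurableC mA.
have mXA : measurable (X @^-1` (~` A)).
  by rewrite -[_ @^-1` _]setTI; exact: mX.
have mYA : measurable (Y @^-1` (~` A)).
  by rewrite -[_ @^-1` _]setTI; exact: mY.
move=> /(negligibleP P mYA) Y0; apply/(negligibleP P mXA).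
exact: etrans (XY _ mAC) Y0.
Qed.

End VectorLaws.

(** * The corrupted linear model *)

Section Population.
Context {dO : measure_display} {Om : measurableType dO} {R : realType}.
Variables (P : probability Om R) (d : nat) (D sigma alpha : R).
Variables (x : Om -> 'rV[R]_d) (eps b : Om -> R).
Hypotheses (D0 : 0 < D) (s0 : 0 <= sigma) (mx : measurable_coords x)
  (meps : measurable_fun setT eps) (mb : measurable_fun setT b).
Let G (k : 'I_3) : set (set Om) :=
  if val k == 0%N then sigma_vec x
  else if val k == 1%N then sigma_real eps else sigma_real b.
Hypotheses (ind : mutually_indep P G)
  (x1 : {ae P, forall o, enorm (x o) <= 1})
  (Ex : forall i : 'I_d, ('E_P[fun o => x o ord0 i] = 0)%E)
  (eps_le : {ae P, forall o, `|eps o| <= sigma})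
  (b_neq0 : P [set o | b o != 0] = alpha%:E).

Let GI k : setI_closed (G k).
Proof.
rewrite /G; case: ifP => _; last case: ifP => _; last first.
- exact: (preimages_setI b).
- exact: (preimages_setI eps).
- exact: (preimages_setI (x : Om -> mxT R d)).
Qed.

Let GT k : G k setT.
Proof.
rewrite /G; case: ifP => _; last case: ifP => _; last first.
- exact: (preimagesT b).
- exact: (preimagesT eps).
- exact: (preimagesT (x : Om -> mxT R d)).
Qed.

Let Gm k : G k `<=` measurable.
Proof.
rewrite /G; case: ifP => _; last case: ifP => _; last first.
- exact: (preimages_measurable b).
- exact: (preimages_measurable eps).
- exact/(preimages_measurable (x : Om -> mxT R d))/measurable_coordsP.
Qed.

(** The indices of [eps] and [b]; [S] then carries the sigma-algebra of the whole noise. *)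
Let J : {set 'I_3} := [set~ ord0].
Let S := g_sigma_algebraType (meet_system G J).

Let meps_S : measurable_fun setT (eps : S -> R).
Proof.
apply: (measurable_meet_system G GT J (inord 1)).
  by rewrite !inE -val_eqE /= inordK.
by move=> B mB; rewrite /G /= inordK//=; exists B.
Qed.

Let mb_S : measurable_fun setT (b : S -> R).
Proof.
apply: (measurable_meet_system G GT J (inord 2)).
  by rewrite !inE -val_eqE /= inordK.
by move=> B mB; rewrite /G /= inordK//=; exists B.
Qed.

(** Mutual independence makes the sigma-algebra of [S] independent of [x], and any function of the
    pair [(eps, b)] is measurable for it. *)
Lemma noise_indep_input (f : R * R -> R) (g : mxT R d -> R) :
  measurable_fun setT f -> measurable_fun setT g ->
  ae_bounded P (fun o => f (eps o, b o)) -> ae_bounded P (g \o x) ->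
  \int[P]_o (f (eps o, b o) * g (x o)) =
  (\int[P]_o f (eps o, b o)) * (\int[P]_o g (x o)).
Proof.
move=> mf mg bf bg.
apply: (@indep_RintegralM _ _ _ P _ _ S (mxT R d) id x
  (fun o => f (eps o, b o)) g) => //.
- exact: (measurable_id_meet_system _ Gm).
- exact: measurable_coordsP.
- apply: (indep_maps_meet_system P G GI GT Gm ind J ord0).
    by rewrite !inE eqxx.
  by move=> B mB; rewrite /G /=; exists B.
- by apply: (measurableT_comp mf); exact: measurable_fun_pair.
Qed.

Let bdotv (u : 'rV[R]_d) : ae_bounded P (fun o => dotv u (x o)).
Proof. exact: (ae_bounded_dotv _ _ _ _ (enorm u) (measurable_coords_cst _ _)). Qed.

Lemma measurable_dotv_mxT (u : 'rV[R]_d) :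
  measurable_fun setT (fun v : mxT R d => dotv u v).
Proof.
apply: measurable_fun_dotv; first exact: measurable_coords_cst.
exact: measurable_coords_id.
Qed.

Lemma ae_bounded_eps : ae_bounded P eps.
Proof. by split=> //; exists sigma. Qed.

Lemma Rintegral_dotv0 (u : 'rV[R]_d) : \int[P]_o dotv u (x o) = 0.
Proof.
have bx i : ae_bounded P (fun o => x o ord0 i).
  split; first exact: mx.
  exists 1; move: x1; apply: filterS => o; apply: le_trans.
  exact: normr_coord_le.
(* The coordinates are extended by 0 to all naturals, the index type of [Rintegral_sum]. *)
pose f (t : nat) o := if insub t is Some i then u ord0 i * x o ord0 i else 0.
have fE o : dotv u (x o) = \sum_(t < d) f t o.
  by apply: eq_bigr => i _; rewrite /f valK.
under eq_Rintegral do rewrite fE.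
have bf t : (t < d)%N -> ae_bounded P (f t).
  move=> td; rewrite /f insubT.
  exact: (ae_boundedM _ _ _ (ae_bounded_cst _ (u ord0 (Sub t td))) (bx _)).
rewrite Rintegral_sum//; apply: big1 => i _; rewrite /f valK.
rewrite RintegralZl//; last exact: ae_boundedP.
by have := Ex i; rewrite unlock /Rintegral => ->; rewrite mulr0.
Qed.

(** The quadratic form of the covariance matrix of the centred vector [x]; half its value at
    [w - wstar] is the excess risk of [w]. *)
Definition qform (u : 'rV[R]_d) : R := \int[P]_o (dotv u (x o) ^+ 2).

Lemma qform_ge0 u : 0 <= qform u.
Proof. by apply: Rintegral_ge0 => o _; exact: sqr_ge0. Qed.

Lemma qform_le u : qform u <= enorm u ^+ 2.
Proof.
rewrite -[leRHS](Rintegral_cstT P); apply: ae_le_Rintegral.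
- exact: ae_bounded_sqr.
- exact: ae_bounded_cst.
move: x1; apply: filterS => o xo.
rewrite -real_normK ?num_real// ler_sqr ?nnegrE ?enorm_ge0//.
by rewrite (le_trans (normr_dotv_le _ _))// ler_piMr// enorm_ge0.
Qed.

Lemma measurable_uncorrupted :
  measurable_fun setT (fun z : R * R => (z.2 == 0)%:R : R).
Proof.
have -> : (fun z : R * R => (z.2 == 0)%:R : R) =
    (\1_[set (0 : R)] : R -> R) \o snd.
  apply/funext => z; rewrite /= indicE.
  have [->|z0] := eqVneq z.2 0; first by rewrite mem_set.
  by rewrite memNset//= => /eqP; apply/negP.
apply: (measurableT_comp (f := \1_[set (0 : R)] : R -> R));
  last exact: measurable_snd.
by apply: measurable_indic.
Qed.

Lemma ae_bounded_uncorrupted : ae_bounded P (fun o => (b o == 0)%:R : R).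
Proof.
split.
  exact: (measurableT_comp measurable_uncorrupted (measurable_fun_pair meps mb)).
by exists 1; apply: aeW => o; case: eqP => _; rewrite ?normr0 ?normr1.
Qed.

(** Independence of [b] and [x] splits off the factor [P (b = 0) = 1 - alpha]. *)
Lemma Rintegral_uncorrupted (u : 'rV[R]_d) :
  \int[P]_o ((b o == 0)%:R * dotv u (x o) ^+ 2) = (1 - alpha) * qform u.
Proof.
have mb0 : measurable [set o | b o != 0].
  have -> : [set o | b o != 0] = b @^-1` [set~ 0].
    by apply/seteqP; split => o /= /eqP.
  by rewrite -[_ @^-1` _]setTI; apply: mb => //; exact: measurableC.
have mg : measurable_fun setT (fun v : mxT R d => dotv u v ^+ 2).
  by apply: measurable_funX; exact: measurable_dotv_mxT.
have := noise_indep_input _ _ measurable_uncorrupted mg ae_bounded_uncorrupted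
  (ae_bounded_sqr _ _ (bdotv u)).
move=> /= ->; congr (_ * _).
transitivity (\int[P]_o \1_(~` [set o | b o != 0]) o).
  apply: eq_Rintegral => o _; rewrite indicE.
  have [b0|bn0] := eqVneq (b o) 0; first by rewrite mem_set//= b0 eqxx.
  by rewrite memNset//=; apply.
rewrite /Rintegral integral_indic//; last exact: measurableC.
by rewrite setIT /= probability_setC// b_neq0.
Qed.

(** Integrated form of [phiR_mul_ge] at [s = <w - ws, x>] and [e = eps]. *)
Lemma population_gradient_ge (w ws : 'rV[R]_d) :
  let r := 6 * D + sigma in enorm w <= D -> enorm ws <= D ->
  (1 - alpha) * qform (w - ws) <=
  \int[P]_o (dotv (w - ws) (x o) *
             phiR r (dotv w (x o) - (dotv ws (x o) + eps o + b o))).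
Proof.
move=> r wD wsD; set u := w - ws.
have r0 : 0 <= r by rewrite addr_ge0// mulr_ge0// ltW.
have mphi : measurable_fun setT (fun z : R * R => phiR r (- z.1 - z.2)).
  apply: measurable_phiR; apply: measurable_funB => //.
  by apply: measurableT_comp => //; exact: measurable_fst.
have bphi : ae_bounded P (fun o => phiR r (- eps o - b o)).
  apply: ae_bounded_phiR => //; apply: measurable_funB => //.
  exact: measurableT_comp.
have bz := ae_bounded_uncorrupted.
have E0 : \int[P]_o (dotv u (x o) * phiR r (- eps o - b o)) = 0.
  under eq_Rintegral do rewrite mulrC.
  have := noise_indep_input _ _ mphi (measurable_dotv_mxT u) bphi (bdotv u).
  move=> /= ->.
  by rewrite Rintegral_dotv0 mulr0.
(* [E0] enters as a zero on the left, so that both sides become integrals of the two sides of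
   [phiR_mul_ge]. *)
rewrite -[leLHS]add0r -E0 -Rintegral_uncorrupted -RintegralD//; last 2 first.
- by apply: ae_boundedP; exact: ae_boundedM.
- by apply: ae_boundedP; apply: ae_boundedM => //; exact: ae_bounded_sqr.
apply: ae_le_Rintegral.
- apply: ae_boundedD; first exact: ae_boundedM.
  by apply: ae_boundedM => //; exact: ae_bounded_sqr.
- apply: ae_boundedM => //; apply: ae_bounded_phiR => //.
  apply: measurable_funB; first by case: (bdotv w).
  apply: measurable_funD => //; apply: measurable_funD => //.
  by case: (bdotv ws).
move: x1 eps_le; apply: filterS2 => o xo eo.
have -> : dotv w (x o) - (dotv ws (x o) + eps o + b o) =
    dotv u (x o) - eps o - b o by rewrite dotvBl; ring.
apply: phiR_mul_ge; rewrite lerD// (le_trans (normr_dotv_le _ _))//.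
(* [|<w - ws, x>| <= |w| + |ws| <= 2 D], which is within the [6 * D] of the clipping radius. *)
apply: (@le_trans _ _ (2 * D)); last by rewrite ler_pM2r// ler_nat.
apply: (@le_trans _ _ (enorm u)); first by rewrite ler_piMr// enorm_ge0.
by rewrite (le_trans (enormB_le _ _))// mulr_natl mulr2n lerD.
Qed.

(** The residual at [w] is [<u, x> - eps] with [u = w - ws]; the cross term of its square has mean
    zero because [x] is centred and independent of [eps]. *)
Lemma Frisk_excess (w ws : 'rV[R]_d) :
  Frisk P x eps ws w = Frisk P x eps ws ws + 2^-1 * qform (w - ws).
Proof.
set u := w - ws.
have bs := bdotv u; have be := ae_bounded_eps.
have E0 : \int[P]_o (eps o * dotv u (x o)) = 0.
  have := noise_indep_input _ _ measurable_fst (measurable_dotv_mxT u) be bs.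
  by move=> /= ->; rewrite Rintegral_dotv0 mulr0.
pose c : Om -> R := fun=> 2^-1.
have bc : ae_bounded P c by exact: ae_bounded_cst.
have bee := ae_boundedM _ _ _ bc (ae_bounded_sqr _ _ be).
have bss := ae_boundedM _ _ _ bc (ae_bounded_sqr _ _ bs).
have bes := ae_boundedM _ _ _ be bs.
rewrite /Frisk unlock.
transitivity (\int[P]_o (2^-1 * eps o ^+ 2 + 2^-1 * dotv u (x o) ^+ 2 -
    eps o * dotv u (x o))).
  apply: eq_Rintegral => o _; rewrite dotvBl.
  by field.
rewrite RintegralB//; last 2 first.
- by apply: ae_boundedP; exact: ae_boundedD.
- exact: ae_boundedP.
rewrite E0 subr0 RintegralD//; last 2 first.
- exact: ae_boundedP.
- exact: ae_boundedP.
congr (_ + _).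
  by apply: eq_Rintegral => o _; rewrite subrr sub0r sqrrN.
by rewrite RintegralZl//; exact/ae_boundedP/ae_bounded_sqr.
Qed.

(** Tonelli on [Om * Om]: the second copy of [Om] carries the integration variable of [qform], the
    first the random vector [W]. *)
Lemma measurable_qform (W : Om -> 'rV[R]_d) : measurable_coords W ->
  measurable_fun setT (fun o => qform (W o)).
Proof.
move=> mW; pose h (z : Om * Om) : \bar R := (dotv (W z.1) (x z.2) ^+ 2)%:E.
have mh : measurable_fun setT h.
  apply/measurable_EFinP/measurable_funX/measurable_fun_dotv => i.
    exact: (measurableT_comp (mW i) measurable_fst).
  exact: (measurableT_comp (mx i) measurable_snd).
have mF : measurable_fun setT (fubini_F P h).
  by apply: measurable_fun_fubini_tonelli_F => // z; rewrite lee_fin sqr_ge0.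
exact: (measurableT_comp (fine_measurable measurableT) mF).
Qed.

Lemma ae_bounded_qform (W : Om -> 'rV[R]_d) (C : R) : measurable_coords W ->
  (forall o, enorm (W o) <= C) -> ae_bounded P (fun o => qform (W o)).
Proof.
move=> mW WC; split; first exact: measurable_qform.
exists (C ^+ 2); apply: aeW => o; rewrite ger0_norm ?qform_ge0//.
rewrite (le_trans (qform_le _))// ler_sqr ?nnegrE ?enorm_ge0//.
exact: le_trans (enorm_ge0 _) (WC o).
Qed.

Lemma qform_mean_le (N : nat) (u : nat -> 'rV[R]_d) : (0 < N)%N ->
  qform (N%:R^-1 *: \sum_(t < N) u t) <= N%:R^-1 * \sum_(t < N) qform (u t).
Proof.
move=> N0; have bs t := ae_bounded_sqr _ _ (bdotv (u t)).
have bS : ae_bounded P (fun o => \sum_(t < N) dotv (u t) (x o) ^+ 2).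
  by apply: (ae_bounded_sum P N (fun t o => dotv (u t) (x o) ^+ 2)).
rewrite -(Rintegral_sum P N (fun t o => dotv (u t) (x o) ^+ 2))//.
rewrite -RintegralZl//; last exact: ae_boundedP.
apply: le_Rintegral => //; [exact/ae_boundedP/ae_bounded_sqr|..].
  exact/ae_boundedP/(ae_boundedM _ _ _ (ae_bounded_cst _ _) bS).
move=> o _; rewrite dotvZl dotv_suml.
exact: (sqr_mean_le N (fun t => dotv (u t) (x o))).
Qed.

(** * The sample sequence and the averaged iterate *)

Variables (T : nat) (wstar : 'rV[R]_d).
Variables (xs : nat -> Om -> 'rV[R]_d) (ys : nat -> Om -> R).
Hypothesis wsD : enorm wstar <= D.
Hypothesis mxys : forall t, (t < T)%N ->
  measurable_coords (xs t) /\ measurable_fun setT (ys t).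
Let Gs (t : 'I_T) : set (set Om) := sigma_vec (joint (xs t) (ys t)).
Hypothesis inds : mutually_indep P Gs.
Let y o := dotv wstar (x o) + eps o + b o.
Hypothesis law : forall t, (t < T)%N ->
  same_law P (joint (xs t) (ys t)) (joint x y).
Let r := 6 * D + sigma.

Let my : measurable_fun setT y.
Proof.
apply: measurable_funD => //; apply: measurable_funD => //.
by case: (bdotv wstar).
Qed.

Let mjoint t : (t < T)%N -> measurable_coords (joint (xs t) (ys t)).
Proof. by move=> /mxys[? ?]; exact: measurable_coords_joint. Qed.

(** Equality of laws concerns the pairs, so the bound on [x] is phrased as an event on the left
    block of the joint vector before being transferred. *)
Lemma sample_le1 t : (t < T)%N -> {ae P, forall o, enorm (xs t o) <= 1}.
Proof.
move=> tT; pose A : set (mxT R (d + 1)) := [set v | enorm (lsubmx v) <= 1].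
have mA : measurable A.
  have mn : measurable_fun setT (fun v : mxT R (d + 1) => enorm (lsubmx v)).
    apply: measurable_fun_enorm => i; under eq_fun do rewrite mxE.
    exact: measurable_coords_id.
  have := mn measurableT _ (measurable_itv `]-oo, (1 : R)]).
  by rewrite setTI; congr measurable; apply/seteqP; split=> v /=; rewrite in_itv.
have mxy := measurable_coords_joint _ x y mx my.
suff : {ae P, forall o, A (joint (xs t) (ys t) o)}.
  by apply: filterS => o; rewrite /A/= lsubmx_joint.
apply: (same_law_ae _ _ _ _ _ (mjoint t tT) mxy (law t tT) mA).
by move: x1; apply: filterS => o; rewrite /A/= lsubmx_joint.
Qed.

Let Gs_id t : setI_closed (Gs t).
Proof. exact: (preimages_setI (joint (xs t) (ys t) : Om -> mxT R (d + 1))). Qed.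
Let Gs_T t : Gs t setT.
Proof. exact: (preimagesT (joint (xs t) (ys t) : Om -> mxT R (d + 1))). Qed.
Let Gs_m t : Gs t `<=` measurable.
Proof.
apply/(preimages_measurable (joint (xs t) (ys t) : Om -> mxT R (d + 1))).
exact/measurable_coordsP/mjoint.
Qed.

(* Generates the sigma-algebra of the samples preceding [t], to which the
   iterate [w_t] is adapted. *)
Definition past (t : nat) : set (set Om) :=
  meet_system Gs [set i : 'I_T | (i < t)%N].

Lemma measurable_past t (i : 'I_T) : (i < t)%N ->
  measurable_coords (xs i : g_sigma_algebraType (past t) -> 'rV[R]_d) /\
  measurable_fun setT (ys i : g_sigma_algebraType (past t) -> R).
Proof.
move=> it.
have mj : measurable_fun setT (joint (xs i) (ys i) :
    g_sigma_algebraType (past t) -> mxT R (d + 1)).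
  apply: (measurable_meet_system Gs Gs_T _ i); first by rewrite inE.
  by move=> B mB; exists B.
split.
  move=> j; have := measurableT_comp (measurable_coords_id _ (lshift 1 j)) mj.
  by congr measurable_fun; apply/funext => o; rewrite /= row_mxEl.
have := measurableT_comp (measurable_coords_id _ (rshift d ord0)) mj.
by congr measurable_fun; apply/funext => o; rewrite /= last_joint.
Qed.

(** Takes the sample packed as one vector [v = (x, y)], the form in which independence and equality
    of laws are available. *)
Let loss_grad (w : 'rV[R]_d) (v : mxT R (d + 1)) : R :=
  dotv (w - wstar) (lsubmx v) *
  phiR r (dotv w (lsubmx v) - v ord0 (rshift d ord0)).

(** Since [W] depends on the past only, Fubini freezes it while sample [t] is integrated; that
    sample is then exchanged for [(x, y)] by equality of laws, and [population_gradient_ge] applies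
    for each frozen value. *)
Lemma sample_gradient_ge (t : 'I_T)
    (W : g_sigma_algebraType (past t) -> 'rV[R]_d) :
  measurable_coords W -> (forall o, enorm (W o) <= D) ->
  (1 - alpha) * (\int[P]_o qform (W o - wstar)) <=
  \int[P]_o (dotv (W o - wstar) (xs t o) *
             phiR r (dotv (W o) (xs t o) - ys t o)).
Proof.
move=> mW WD; have tT := ltn_ord t; have [mxt myt] := mxys t tT.
have r0 : 0 <= r by rewrite addr_ge0// mulr_ge0// ltW.
have mid := measurable_id_meet_system Gs Gs_m [set i : 'I_T | (i < t)%N].
have mWO : measurable_coords (W : Om -> 'rV[R]_d).
  by move=> i; exact: (measurableT_comp (mW i) mid).
have bgrad (V : Om -> 'rV[R]_d) (X : Om -> 'rV[R]_d) (Y : Om -> R) :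
    measurable_coords V -> (forall o, enorm (V o) <= D) ->
    measurable_coords X -> measurable_fun setT Y ->
    {ae P, forall o, enorm (X o) <= 1} ->
    ae_bounded P (fun o => loss_grad (V o) (joint X Y o)).
  move=> mV VD mX mY X1; rewrite /loss_grad.
  under eq_fun do rewrite lsubmx_joint last_joint.
  apply: ae_boundedM.
    apply: (ae_bounded_dotv _ _ _ _ (D + D)) => //.
      by apply: measurable_coordsB => //; exact: measurable_coords_cst.
    by move=> o; rewrite (le_trans (enormB_le _ _))// lerD.
  apply: ae_bounded_phiR => //; apply: measurable_funB => //.
  exact: measurable_fun_dotv.
(* Stated on an arbitrary domain: it is applied to the product space in Fubini and to
   [mxT R (d + 1)] with a frozen iterate. *)
have mgrad dT (T' : measurableType dT) (V : T' -> 'rV[R]_d)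
    (U : T' -> mxT R (d + 1)) : measurable_coords V -> measurable_fun setT U ->
    measurable_fun setT (fun z => loss_grad (V z) (U z)).
  move=> mV mU.
  have ml : measurable_coords (fun z => lsubmx (U z)).
    move=> i; under eq_fun do rewrite mxE.
    exact: (measurableT_comp (measurable_coords_id _ _) mU).
  apply: measurable_funM.
    by apply: measurable_fun_dotv => //; exact: measurable_coordsB.
  apply: measurable_phiR; apply: measurable_funB.
    exact: measurable_fun_dotv.
  exact: (measurableT_comp (measurable_coords_id _ _) mU).
have indt : indep_maps P (id : Om -> g_sigma_algebraType (past t))
    (joint (xs t) (ys t) : Om -> mxT R (d + 1)).
  apply: (indep_maps_meet_system P Gs Gs_id Gs_T Gs_m inds _ t).
    by rewrite inE ltnn.
  by move=> B mB; exists B.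
have [|||iF] := indep_Rintegral P _ _ mid
  (measurable_coordsP _ _ (mjoint t tT)) indt (fun z => loss_grad (W z.1) z.2).
- apply: mgrad => [i|]; last exact: measurable_snd.
  exact: (measurableT_comp (mW i) measurable_fst).
- by apply: ae_boundedP; apply: bgrad => //; exact: sample_le1.
- move=> a; apply: ae_boundedP.
  by apply: (bgrad (fun=> W a)) => //; exact: sample_le1.
rewrite /= {1}/loss_grad.
under eq_Rintegral do rewrite lsubmx_joint last_joint.
move=> ->.
have bq : ae_bounded P (fun o => qform (W o - wstar)).
  apply: (ae_bounded_qform _ (D + D)).
    by apply: measurable_coordsB => //; exact: measurable_coords_cst.
  by move=> o; rewrite (le_trans (enormB_le _ _))// lerD.
rewrite -RintegralZl//; last exact: ae_boundedP.
apply: le_Rintegral => //.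
  exact/ae_boundedP/(ae_boundedM _ _ _ (ae_bounded_cst _ (1 - alpha)) bq).
move=> o _; rewrite (le_trans (population_gradient_ge _ _ (WD o) wsD))//.
(* With [W o] frozen, sample [t] is replaced by the pair [(x, y)]. *)
rewrite (same_law_Rintegral _ _ _ _ (loss_grad (W o)) (mjoint t tT)
  (measurable_coords_joint _ _ _ mx my) (law t tT)).
- rewrite le_eqVlt; apply/orP; left; apply/eqP.
  by apply: eq_Rintegral => o' _; rewrite /loss_grad lsubmx_joint last_joint.
- exact: (mgrad _ _ (fun=> W o) id).
- by apply: (bgrad (fun=> W o)) => //; exact: sample_le1.
- exact: (bgrad (fun=> W o)).
Qed.

(** Convexity bounds the value at the average by the average of the values, whose mean is controlled
    by [sample_gradient_ge] and the regret bound. Boundedness is returned as well, for the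
    integration of [F] at the output. *)
Lemma sgd_qform_le : (0 < T)%N -> alpha < 1 ->
  ae_bounded P (fun o => qform (sgd_out T D r (xs^~ o) (ys^~ o) - wstar)) /\
  \int[P]_o qform (sgd_out T D r (xs^~ o) (ys^~ o) - wstar) <=
  r * D / ((1 - alpha) * Num.sqrt T%:R).
Proof.
move=> T0 alpha1; set s := Num.sqrt T%:R.
have s0' : 0 < s by rewrite sqrtr_gt0 ltr0n.
have sT : s ^+ 2 = T%:R by rewrite sqr_sqrtr// ler0n.
have r0 : 0 < r by rewrite ltr_wpDr// mulr_gt0.
pose eta := D / (r * s); have eta0 : 0 < eta by rewrite divr_gt0// mulr_gt0.
pose W t o := sgd_w D r eta (xs^~ o) (ys^~ o) t.
have WD t o : enorm (W t o) <= D by exact: sgd_w_le.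
have mW t : (t < T)%N -> measurable_coords (W t).
  move=> tT; apply: measurable_sgd_w => // k kt.
  exact: mxys (ltn_trans kt tT).
have mWB t : (t < T)%N -> measurable_coords (fun o => W t o - wstar).
  by move=> tT; apply: measurable_coordsB; [exact: mW|].
have WBD t o : enorm (W t o - wstar) <= D + D.
  by rewrite (le_trans (enormB_le _ _))// lerD.
have bq t : (t < T)%N -> ae_bounded P (fun o => qform (W t o - wstar)).
  by move=> tT; apply: (ae_bounded_qform _ (D + D)) => //; exact: mWB.
have bavg : ae_bounded P (fun o => T%:R^-1 * \sum_(t < T) qform (W t o - wstar)).
  apply: ae_boundedM; first exact: ae_bounded_cst.
  exact: (ae_bounded_sum P T (fun t o => qform (W t o - wstar))).
have outE o : sgd_out T D r (xs^~ o) (ys^~ o) - wstar =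
    T%:R^-1 *: \sum_(t < T) (W t o - wstar).
  rewrite sumrB scalerBr sumr_const card_ord -[wstar *+ T]scaler_nat scalerA mulVf.
    by rewrite scale1r.
  by rewrite pnatr_eq0 -lt0n.
have qavg o : qform (sgd_out T D r (xs^~ o) (ys^~ o) - wstar) <=
    T%:R^-1 * \sum_(t < T) qform (W t o - wstar).
  by rewrite outE; exact: (qform_mean_le T (fun t => W t o - wstar)).
have bout : ae_bounded P
    (fun o => qform (sgd_out T D r (xs^~ o) (ys^~ o) - wstar)).
  split; last first.
    have [_ [M bM]] := bavg; exists M; move: bM; apply: filterS => o.
    apply: le_trans; rewrite ger0_norm ?qform_ge0//.
    exact: le_trans (qavg o) (ler_norm _).
  apply: measurable_qform; under eq_fun do rewrite outE.
  apply: measurable_coordsZ => //.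
  exact: (measurable_coords_sum _ T (fun t o => W t o - wstar)).
split=> //.
pose f t o := dotv (W t o - wstar) (xs t o) *
  phiR r (dotv (W t o) (xs t o) - ys t o).
have bf t : (t < T)%N -> ae_bounded P (f t).
  move=> tT; have [mxt myt] := mxys t tT; apply: ae_boundedM.
    apply: (ae_bounded_dotv _ _ _ _ (D + D)) => //; first exact: mWB.
    exact: sample_le1.
  apply: ae_bounded_phiR; first exact: ltW.
  by apply: measurable_funB => //; apply: measurable_fun_dotv => //; exact: mW.
have fq t : (t < T)%N ->
    (1 - alpha) * (\int[P]_o qform (W t o - wstar)) <= \int[P]_o f t o.
  (* [W t] is built from the samples before [t], hence measurable for [past t]. *)
  move=> tT; apply: (sample_gradient_ge (Ordinal tT)) => //=.
  apply: measurable_sgd_w => // k kt.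
  exact: (measurable_past t (Ordinal (ltn_trans kt tT))).
(* The regret bound needs all samples bounded at once: the finitely many almost sure events are
   merged by induction. *)
have xs1 : {ae P, forall o, forall t, (t < T)%N -> enorm (xs t o) <= 1}.
  have : forall k, (k <= T)%N ->
      {ae P, forall o, forall t, (t < k)%N -> enorm (xs t o) <= 1}.
    elim=> [_|k IH kT]; first by apply: aeW.
    move: (IH (ltnW kT)) (sample_le1 k kT); apply: filterS2 => o h hk t.
    by rewrite ltnS leq_eqVlt => /predU1P[->|/h].
  exact.
have regret : {ae P, forall o, \sum_(t < T) f t o <= r * D * s}.
  move: xs1; apply: filterS => o xs1.
  have := sgd_regret D r eta (xs^~ o) (ys^~ o) D0 (ltW r0) T wstar wsD xs1.
  rewrite (eq_bigr (fun t : 'I_T => f t o)); last first.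
    by move=> t _; rewrite dotvZr mulrC.
  (* The choice of [eta] balances the two terms of the regret bound at [D ^+ 2] each; dividing
     [2 * D ^+ 2] by [2 * eta] gives [r * D * s]. *)
  have -> : T%:R * (eta * r) ^+ 2 = D ^+ 2.
    rewrite -sT /eta; field.
    by rewrite !gt_eqF.
  move=> h; rewrite -(ler_pM2l eta0).
  have -> : eta * (r * D * s) = D ^+ 2.
    by rewrite /eta; field; rewrite !gt_eqF.
  by lra.
have bF : ae_bounded P (fun o => \sum_(t < T) f t o) by exact: ae_bounded_sum.
have IF := ae_le_Rintegral _ _ _ bF (ae_bounded_cst _ _) regret.
rewrite Rintegral_cstT Rintegral_sum// in IF.
have a0 : 0 < 1 - alpha by rewrite subr_gt0.
have Tn0 : 0 < T%:R :> R by rewrite ltr0n.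
apply: le_trans (ae_le_Rintegral _ _ _ bout bavg (aeW _ qavg)) _.
have bsum : ae_bounded P (fun o => \sum_(t < T) qform (W t o - wstar)).
  exact: (ae_bounded_sum P T (fun t o => qform (W t o - wstar))).
rewrite RintegralZl//; last exact: ae_boundedP.
rewrite (Rintegral_sum P T (fun t o => qform (W t o - wstar)))//.
rewrite -(ler_pM2l a0) mulrCA mulr_sumr.
(* Averaging divides by [T = s ^+ 2], which turns [r * D * s] into [r * D / s]. *)
have -> : (1 - alpha) * (r * D / ((1 - alpha) * s)) = T%:R^-1 * (r * D * s).
  by rewrite -sT; field; rewrite !gt_eqF.
rewrite ler_pM2l ?invr_gt0//; apply: le_trans IF.
by apply: ler_sum => t _; exact: fq.
Qed.

End Population.

Theorem theorem1 (R : realType) (dO : measure_display) (Om : measurableType dO)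
  (P : probability Om R)
  (d T : nat) (D sigma alpha : R) (wstar : 'rV[R]_d)
  (x : Om -> 'rV[R]_d) (eps b : Om -> R)
  (xs : nat -> Om -> 'rV[R]_d) (ys : nat -> Om -> R) :
  (0 < d)%N -> 0 < D -> 0 <= sigma -> 0 <= alpha -> alpha < 1 -> (0 < T)%N ->
  enorm wstar <= D ->
  (* (x, eps, b) are random variables *)
  (forall i : 'I_d, measurable_fun setT (fun o => x o ord0 i)) ->
  measurable_fun setT eps -> measurable_fun setT b ->
  (* mutually independent *)
  mutually_indep P (fun k : 'I_3 =>
     if val k == 0%N then sigma_vec x
     else if val k == 1%N then sigma_real eps else sigma_real b) ->
  {ae P, forall o, enorm (x o) <= 1} ->
  (forall i : 'I_d, ('E_P[fun o => x o ord0 i] = 0)%E) ->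
  {ae P, forall o, `|eps o| <= sigma} ->
  ('E_P[eps] = 0)%E ->
  P [set o | b o != 0] = alpha%:E ->
  (* samples (x_t, y_t), t = 0..T-1: random variables, mutually independent,
     each distributed as (x, y) with y = <w*,x> + eps + b *)
  (forall t : nat, (t < T)%N ->
     (forall i : 'I_d, measurable_fun setT (fun o => xs t o ord0 i)) /\
     measurable_fun setT (ys t)) ->
  mutually_indep P (fun t : 'I_T => sigma_vec (joint (xs t) (ys t))) ->
  (forall t : nat, (t < T)%N ->
     same_law P (joint (xs t) (ys t))
       (joint x (fun o => dotv wstar (x o) + eps o + b o))) ->
  let Rr := 6 * D + sigma in
  let F := Frisk P x eps wstar in
  ('E_P[fun o => F (sgd_out T D Rr (fun t => xs t o) (fun t => ys t o))]
     - (F wstar)%:E <= (Rr * D / ((1 - alpha) * Num.sqrt T%:R))%:E)%E.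
Proof.
move=> _ D0 s0 _ alpha1 T0 wsD mx meps mb ind x1 Ex eps_le _ b_neq0 mxys inds law.
cbv zeta; set Rr := 6 * D + sigma; set F := Frisk P x eps wstar.
have [bq qle] := sgd_qform_le P d D sigma alpha x eps b D0 s0 mx meps mb
  ind x1 Ex eps_le b_neq0 T wstar xs ys wsD mxys inds law T0 alpha1.
have FE w : F w = F wstar + 2^-1 * qform P d x (w - wstar).
  exact: (Frisk_excess P d sigma x eps b mx meps mb ind x1 Ex eps_le).
have q0 : 0 <= \int[P]_o qform P d x
    (sgd_out T D Rr (xs^~ o) (ys^~ o) - wstar).
  by apply: Rintegral_ge0 => o _; exact: qform_ge0.
pose c : Om -> R := fun=> 2^-1.
have bhalf := ae_boundedM _ _ _ (ae_bounded_cst P 2^-1) bq.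
have bF := ae_boundedD _ _ _ (ae_bounded_cst P (F wstar)) bhalf.
(* Boundedness makes the extended-real expectation finite, so the rest is an inequality between
   reals. *)
have -> : ('E_P[fun o => F (sgd_out T D Rr (xs^~ o) (ys^~ o))] =
    (\int[P]_o F (sgd_out T D Rr (xs^~ o) (ys^~ o)))%:E)%E.
  rewrite unlock fineK// integrable_fin_num//; apply: ae_boundedP.
  by under eq_fun do rewrite FE.
rewrite -EFinB lee_fin.
under eq_Rintegral do rewrite FE.
rewrite RintegralD//; [|exact/ae_boundedP/ae_bounded_cst|exact: ae_boundedP].
rewrite Rintegral_cstT RintegralZl//; last exact: ae_boundedP.
(* [F wstar] cancels, and half of the integral of [qform] is at most the integral itself by [q0]. *)
by apply: le_trans qle; lra.
Qed.
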